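(* Let $f$ be a transcendental entire function which is strongly log-regular. Then $Q_2(f)=A(f)$.
   Context: For a transcendental entire function $f$, $f^n$ denotes the $n$th iterate, and $M(r)=M(r,f)=\max_{|z|=r}|f(z)|$ for $r>0$; $M^n(r,f)$ denotes the $n$th iterate of the function $r\mapsto M(r,f)$. A transcendental entire function $f$ is strongly log-regular if, for every $\varepsilon\in(0,1)$, there exist $R>0$ and $k>1$ such that $\log M(r^k)\ge(k\log M(r))^{1/\varepsilon}$ for all $r>R$. Fast escaping set: $A(f)=\{z\in\mathbb{C}:\text{ there exists }\ell\in\mathbb{N}\text{ such that }|f^{n+\ell}(z)|\ge M^n(R,f)\text{ for all }n\in\mathbb{N}\}$, where $R>0$ is large enough that $M(r,f)>r$ for all $r\ge R$ (the set does not depend on the choice of such $R$). For $\varepsilon\in(0,1)$ let $\mu_{2,\varepsilon}(r)=\exp((\log M(r,f))^{\varepsilon})$, defined for $r$ with $M(r,f)\ge 1$, and let $\mu_{2,\varepsilon}^n$ denote its $n$th iterate. The set $Q_2(f)$ consists of all $z\in\mathbb{C}$ for which there exist $\varepsilon\in(0,1)$, $\ell\in\mathbb{N}$ and $R>0$ with $\mu_{2,\varepsilon}(r)>r$ for all $r\ge R$, such that $|f^{n+\ell}(z)|\ge\mu_{2,\varepsilon}^n(R)$ for all $n\in\mathbb{N}$ (for given $\varepsilon$ the choice of such $R$ does not affect the set). *)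

(* Defs.v *)
From Stdlib Require Import Reals.
From Coquelicot Require Import Coquelicot.
Open Scope R_scope.

(** The field argument of [ex_derive] is forced to be [C_AbsRing]: this is
    complex, not real, differentiability. *)
Definition entire (f : C -> C) : Prop :=
  forall z : C, @ex_derive C_AbsRing C_NormedModule f z.

Definition is_polynomial (f : C -> C) : Prop :=
  exists (n : nat) (a : nat -> C),
    forall z : C, f z = sum_n (fun k => (a k * z ^ k)%C) n.

Definition transcendental_entire (f : C -> C) : Prop :=
  entire f /\ ~ is_polynomial f.

(** For entire [f] and [r >= 0] the circle is compact and nonempty, so the least
    upper bound is finite and is the maximum of [|f|] on [|z| = r].  For [r < 0]
    the value is meaningless. *)
Definition M (f : C -> C) (r : R) : R :=
  real (Lub_Rbar (fun y => exists z : C, Cmod z = r /\ y = Cmod (f z))).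

(** [Rpower x a] is [exp (a * ln x)], hence [1] at [x = 0] since [ln 0 = 0].
    Here [0 ^ a = 0], as it must be for exponents [a > 0]; negative bases also
    give [0]. *)
Definition rpow (x a : R) : R :=
  if Rlt_dec 0 x then Rpower x a else 0.

Definition strongly_log_regular (f : C -> C) : Prop :=
  forall eps : R, 0 < eps < 1 ->
    exists R0 k : R, 0 < R0 /\ 1 < k /\
      forall r : R, R0 < r ->
        rpow (k * ln (M f r)) (1 / eps) <= ln (M f (rpow r k)).

Definition exceeds_id_from (g : R -> R) (R0 : R) : Prop :=
  0 < R0 /\ forall r : R, R0 <= r -> r < g r.

(** [A(f)], computed with the radius [R0]; meant for [R0] such that
    [exceeds_id_from (M f) R0]. *)
Definition A (f : C -> C) (R0 : R) (z : C) : Prop :=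
  exists l : nat, forall n : nat,
    Nat.iter n (M f) R0 <= Cmod (Nat.iter (n + l) f z).

(** Meaningful only where [1 <= M f r]. *)
Definition mu2 (f : C -> C) (eps r : R) : R :=
  exp (rpow (ln (M f r)) eps).

(** The condition [1 <= M f r] says that [mu2 f eps] is defined on [[R0, oo)],
    which contains all the iterates of [R0]. *)
Definition Q2 (f : C -> C) (z : C) : Prop :=
  exists (eps : R) (l : nat) (R0 : R),
    0 < eps < 1 /\
    (forall r : R, R0 <= r -> 1 <= M f r) /\
    exceeds_id_from (mu2 f eps) R0 /\
    forall n : nat,
      Nat.iter n (mu2 f eps) R0 <= Cmod (Nat.iter (n + l) f z).

(* Main.v *)
Require Import Defs.
From Stdlib Require Import Reals Lra Lia Classical ClassicalEpsilon.
From Coquelicot Require Import Coquelicot.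
Open Scope R_scope.

(** Put [phi(t) = log M(e^t)] and let [k] be given by strong log-regularity.  For [eps = 1/2]
    the bound [phi(log s^k) >= (k phi(log s))^2 > (log s^k)^2] yields
    [r < mu2 r <= M r] for large [r], so the iterates of [mu2] are eventually
    dominated by those of [M] and [A(f)] is contained in [Q2(f)].  Conversely, for any
    [eps] the regularity condition says exactly [mu2 (r^k) >= (M r)^k], hence
    inductively [mu2^n (r^k) >= (M^n r)^k >= M^n r].

    Both inductions need that [M] is nondecreasing, i.e. the maximum principle.  By
    Goursat's lemma in logarithmic polar coordinates a function holomorphic on the
    closed unit disc has the mean value property at [0]; composing with a Moebius
    automorphism of the disc moves [0] to any other point. *)

(** * Goursat's lemma *)

(** Outward flux of the field [(p, q)] through the boundary of a rectangle. For [p = Re h] and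
    [q = - Im h] it is the imaginary part of the contour integral of [h]. *)
Definition flux (p q : R -> R -> R) (x1 x2 y1 y2 : R) : R :=
  RInt (fun y => p x2 y) y1 y2 - RInt (fun y => p x1 y) y1 y2
  + (RInt (fun x => q x y2) x1 x2 - RInt (fun x => q x y1) x1 x2).

Lemma continuity_2d_pt_slice_l (f : R -> R -> R) (x y : R) :
  continuity_2d_pt f x y -> continuous (fun t => f t y) x.
Proof.
intros H. apply continuity_pt_filterlim. intros eps Heps.
destruct (H (mkposreal eps Heps)) as [d Hd].
exists d. split. apply cond_pos.
intros t [_ Ht]. apply Hd. exact Ht.
rewrite Rminus_eq_0, Rabs_R0. apply cond_pos.
Qed.

Lemma continuity_2d_pt_slice_r (f : R -> R -> R) (x y : R) :
  continuity_2d_pt f x y -> continuous (fun t => f x t) y.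
Proof.
intros H. apply continuity_pt_filterlim. intros eps Heps.
destruct (H (mkposreal eps Heps)) as [d Hd].
exists d. split. apply cond_pos.
intros t [_ Ht]. apply Hd.
rewrite Rminus_eq_0, Rabs_R0. apply cond_pos. exact Ht.
Qed.

Definition continuous_on_rect (f : R -> R -> R) (x1 x2 y1 y2 : R) : Prop :=
  forall x y, x1 <= x <= x2 -> y1 <= y <= y2 -> continuity_2d_pt f x y.

Lemma ex_RInt_slice_l f x1 x2 y1 y2 a b y :
  continuous_on_rect f x1 x2 y1 y2 ->
  x1 <= a -> a <= b -> b <= x2 -> y1 <= y <= y2 ->
  ex_RInt (fun x => f x y) a b.
Proof.
intros H Ha Hab Hb Hy. apply (@ex_RInt_continuous R_CompleteNormedModule).
intros t. rewrite Rmin_left, Rmax_right by lra. intros Ht.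
apply continuity_2d_pt_slice_l. apply H; lra.
Qed.

Lemma ex_RInt_slice_r f x1 x2 y1 y2 a b x :
  continuous_on_rect f x1 x2 y1 y2 ->
  y1 <= a -> a <= b -> b <= y2 -> x1 <= x <= x2 ->
  ex_RInt (fun y => f x y) a b.
Proof.
intros H Ha Hab Hb Hy. apply (@ex_RInt_continuous R_CompleteNormedModule).
intros t. rewrite Rmin_left, Rmax_right by lra. intros Ht.
apply continuity_2d_pt_slice_r. apply H; lra.
Qed.

(** The integrals over inner edges cancel in pairs. Writing [a + h + h] gives every quarter the form
    corner plus side. *)
Lemma flux_quarter p q x1 x2 y1 y2 a b h k :
  continuous_on_rect p x1 x2 y1 y2 -> continuous_on_rect q x1 x2 y1 y2 ->
  0 <= h -> 0 <= k -> x1 <= a -> a + 2 * h <= x2 -> y1 <= b -> b + 2 * k <= y2 ->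
  flux p q a (a + 2 * h) b (b + 2 * k) =
  flux p q a (a + h) b (b + k) + flux p q (a + h) (a + h + h) b (b + k)
  + flux p q a (a + h) (b + k) (b + k + k)
  + flux p q (a + h) (a + h + h) (b + k) (b + k + k).
Proof.
intros Hp Hq Hh Hk Ha Hah Hb Hbk.
replace (a + 2 * h) with (a + h + h) in * by ring.
replace (b + 2 * k) with (b + k + k) in * by ring.
unfold flux.
assert (E : forall f u v w, ex_RInt f u v -> ex_RInt f v w ->
  RInt f u w = RInt f u v + RInt f v w).
{ intros f u v w Hu Hv. symmetry.
  apply (@RInt_Chasles R_CompleteNormedModule); assumption. }
assert (Ip : forall x, x1 <= x <= x2 -> RInt (fun y => p x y) b (b + k + k) =
  RInt (fun y => p x y) b (b + k) + RInt (fun y => p x y) (b + k) (b + k + k)).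
{ intros x Hx. apply E; eapply ex_RInt_slice_r; try exact Hp; lra. }
assert (Iq : forall y, y1 <= y <= y2 -> RInt (fun x => q x y) a (a + h + h) =
  RInt (fun x => q x y) a (a + h) + RInt (fun x => q x y) (a + h) (a + h + h)).
{ intros x Hx. apply E; eapply ex_RInt_slice_l; try exact Hq; lra. }
rewrite !Ip, !Iq by lra. ring.
Qed.

(** Meant for the restrictions [f] and [g] of one component to opposite edges, with [c] the
    increment predicted by its linear part. *)
Lemma RInt_minus_approx (f g : R -> R) (a b c e : R) :
  a <= b -> ex_RInt f a b -> ex_RInt g a b ->
  (forall t, a <= t <= b -> Rabs (f t - g t - c) <= e) ->
  Rabs (RInt f a b - RInt g a b - c * (b - a)) <= e * (b - a).
Proof.
intros Hab Hf Hg H.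
assert (Hfg := ex_RInt_minus f g a b Hf Hg).
assert (Hc := @ex_RInt_const R_NormedModule a b c).
replace (RInt f a b - RInt g a b - c * (b - a))
  with (RInt (fun t => minus (minus (f t) (g t)) c) a b).
- rewrite (Rmult_comm e). apply abs_RInt_le_const; auto.
  apply (ex_RInt_minus (fun t => minus (f t) (g t)) (fun _ => c)); auto.
- rewrite (RInt_minus (fun t => minus (f t) (g t)) (fun _ => c)) by auto.
  rewrite (RInt_minus f g) by auto. rewrite RInt_const.
  unfold minus, plus, opp, scal; simpl. unfold mult; simpl. ring.
Qed.

(** Between opposite edges the linear parts change by [al * h] and [- al * k]; integrated over edges
    of length [k] and [h] these cancel. Each remainder is at most [eps * (h + k)] on the boundary,
    and integrating it gives the bound. *)
Lemma flux_small p q x y al be ga (eps : posreal) x1 x2 y1 y2 :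
  differentiable_pt_lim p x y al be -> differentiable_pt_lim q x y ga (- al) ->
  x1 <= x <= x2 -> y1 <= y <= y2 ->
  continuous_on_rect p x1 x2 y1 y2 -> continuous_on_rect q x1 x2 y1 y2 ->
  exists d : posreal, forall a b h k, x1 <= a -> a + h <= x2 -> y1 <= b ->
    b + k <= y2 -> a <= x <= a + h -> b <= y <= b + k -> h < d -> k < d ->
    Rabs (flux p q a (a + h) b (b + k)) <= 2 * eps * (h + k) ^ 2.
Proof.
intros Hp Hq Hx Hy Cp Cq.
destruct (Hp eps) as [d1 H1]. destruct (Hq eps) as [d2 H2].
assert (Hd : 0 < Rmin d1 d2) by (apply Rmin_pos; apply cond_pos).
exists (mkposreal _ Hd). simpl.
intros a b h k Ha Hah Hb Hbk Hax Hby Hh Hk.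
assert (Hh1 := Rlt_le_trans _ _ _ Hh (Rmin_l d1 d2)).
assert (Hh2 := Rlt_le_trans _ _ _ Hh (Rmin_r d1 d2)).
assert (Hk1 := Rlt_le_trans _ _ _ Hk (Rmin_l d1 d2)).
assert (Hk2 := Rlt_le_trans _ _ _ Hk (Rmin_r d1 d2)).
assert (He := cond_pos eps).
assert (B : forall u v, a <= u <= a + h -> b <= v <= b + k ->
  Rabs (u - x) <= h /\ Rabs (v - y) <= k /\
  eps * Rmax (Rabs (u - x)) (Rabs (v - y)) <= eps * (h + k)).
{ intros u v Hu Hv.
  assert (Rabs (u - x) <= h) by (apply Rabs_le; lra).
  assert (Rabs (v - y) <= k) by (apply Rabs_le; lra).
  repeat split; auto. apply Rmult_le_compat_l. lra. apply Rmax_lub; lra. }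
assert (Ip : Rabs (RInt (fun y => p (a + h) y) b (b + k)
   - RInt (fun y => p a y) b (b + k) - (al * h) * (b + k - b))
   <= 2 * eps * (h + k) * (b + k - b)).
{ apply RInt_minus_approx; try (eapply ex_RInt_slice_r; try exact Cp); try lra.
  intros t Ht.
  destruct (B (a + h) t) as (B1 & B2 & B3); try lra.
  destruct (B a t) as (B4 & B5 & B6); try lra.
  assert (L1 := H1 (a + h) t ltac:(lra) ltac:(lra)).
  assert (L2 := H1 a t ltac:(lra) ltac:(lra)).
  apply Rabs_le. apply Rabs_le_between in L1. apply Rabs_le_between in L2. lra. }
assert (Iq : Rabs (RInt (fun x => q x (b + k)) a (a + h)
   - RInt (fun x => q x b) a (a + h) - (- al * k) * (a + h - a))
   <= 2 * eps * (h + k) * (a + h - a)).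
{ apply RInt_minus_approx; try (eapply ex_RInt_slice_l; try exact Cq); try lra.
  intros t Ht.
  destruct (B t (b + k)) as (B1 & B2 & B3); try lra.
  destruct (B t b) as (B4 & B5 & B6); try lra.
  assert (L1 := H2 t (b + k) ltac:(lra) ltac:(lra)).
  assert (L2 := H2 t b ltac:(lra) ltac:(lra)).
  apply Rabs_le. apply Rabs_le_between in L1. apply Rabs_le_between in L2. lra. }
unfold flux. apply Rabs_le.
apply Rabs_le_between in Ip. apply Rabs_le_between in Iq. simpl. nra.
Qed.

(** Zero divergence is encoded by the pair [al], [- al] of diagonal partial derivatives. These may
    vary with the point without any continuity. *)
Definition solenoidal_on (p q : R -> R -> R) (x1 x2 y1 y2 : R) : Prop :=
  forall x y, x1 <= x <= x2 -> y1 <= y <= y2 ->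
  exists al be ga, differentiable_pt_lim p x y al be /\
                   differentiable_pt_lim q x y ga (- al).

Lemma solenoidal_continuous p q x1 x2 y1 y2 :
  solenoidal_on p q x1 x2 y1 y2 ->
  continuous_on_rect p x1 x2 y1 y2 /\ continuous_on_rect q x1 x2 y1 y2.
Proof.
intros H. split; intros x y Hx Hy; destruct (H x y Hx Hy) as (al & be & ga & Hp & Hq);
  apply differentiable_continuity_pt; red; eauto.
Qed.

Lemma pow_half_lt (h d : R) : 0 <= h -> 0 < d -> exists n, h * (/ 2) ^ n < d.
Proof.
intros Hh Hd.
destruct (pow_lt_1_zero (/ 2) ltac:(rewrite Rabs_pos_eq; lra) (d / (h + 1))) as [N HN].
apply Rdiv_lt_0_compat; lra.
exists N. specialize (HN N (le_n N)).
assert (0 < (/ 2) ^ N) by (apply pow_lt; lra).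
rewrite Rabs_pos_eq in HN by lra.
apply (Rmult_lt_compat_r (h + 1)) in HN; [|lra].
unfold Rdiv in HN. rewrite Rmult_assoc, Rinv_l, Rmult_1_r in HN by lra. nra.
Qed.

(** The supremum of the left ends lies in all the nested intervals. *)
Lemma nested_limit (a : nat -> R) (h : R) : 0 <= h ->
  (forall n, a n <= a (S n) /\ a (S n) + h * (/ 2) ^ (S n) <= a n + h * (/ 2) ^ n) ->
  exists x, forall n, a n <= x <= a n + h * (/ 2) ^ n.
Proof.
intros Hh H.
assert (P : forall n, 0 <= h * (/ 2) ^ n)
  by (intros n; apply Rmult_le_pos; [|apply pow_le]; lra).
assert (U : forall n m, a n <= a (n + m)%nat /\
  a (n + m)%nat + h * (/ 2) ^ (n + m) <= a n + h * (/ 2) ^ n).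
{ intros n m. induction m as [|m IH].
  - rewrite Nat.add_0_r. lra.
  - rewrite Nat.add_succ_r. destruct (H (n + m)%nat). lra. }
assert (B : forall n m, a m <= a n + h * (/ 2) ^ n).
{ intros n m. destruct (Nat.le_ge_cases n m) as [L|L].
  - replace m with (n + (m - n))%nat by lia. destruct (U n (m - n)%nat).
    specialize (P (n + (m - n))%nat). lra.
  - destruct (U m (n - m)%nat) as [U1 _]. replace (m + (n - m))%nat with n in U1 by lia.
    specialize (P n). lra. }
destruct (completeness (fun t => exists n, t = a n)) as [x [Hx1 Hx2]].
- exists (a 0%nat + h * (/ 2) ^ 0). intros t [n ->]. apply B.
- exists (a 0%nat), 0%nat. reflexivity.
- exists x. intros n. split.
  + apply Hx1. exists n. reflexivity.
  + apply Hx2. intros t [m ->]. apply B.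
Qed.

(* Goursat's lemma: differentiability is only assumed pointwise, so the proof is
   by repeated bisection. *)
Lemma flux_zero p q x1 x2 y1 y2 :
  x1 <= x2 -> y1 <= y2 -> solenoidal_on p q x1 x2 y1 y2 -> flux p q x1 x2 y1 y2 = 0.
Proof.
intros Hx Hy H. destruct (solenoidal_continuous _ _ _ _ _ _ H) as [Cp Cq].
set (h := x2 - x1). set (k := y2 - y1).
set (F := Rabs (flux p q x1 x2 y1 y2)).
set (w := fun n => (/ 2) ^ n).
assert (w_pos : forall n, 0 < w n) by (intros n; apply pow_lt; lra).
assert (w_S : forall n, w n = 2 * w (S n)) by (intros n; unfold w; simpl; field).
(* [c] is the lower left corner of a rectangle scaled by [2^-n] that still carries at least the
   fraction [4^-n] of the flux. *)
set (good := fun n (c : R * R) =>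
  x1 <= fst c /\ fst c + h * w n <= x2 /\ y1 <= snd c /\ snd c + k * w n <= y2 /\
  F * w n ^ 2 <= Rabs (flux p q (fst c) (fst c + h * w n) (snd c) (snd c + k * w n))).
set (sub := fun n (c c' : R * R) =>
  (fst c <= fst c' /\ fst c' + h * w (S n) <= fst c + h * w n) /\
  (snd c <= snd c' /\ snd c' + k * w (S n) <= snd c + k * w n)).
assert (Hh : 0 <= h) by (unfold h; lra). assert (Hk : 0 <= k) by (unfold k; lra).
assert (step : forall n c, good n c -> exists c', good (S n) c' /\ sub n c c').
{ intros n [a b] (G1 & G2 & G3 & G4 & G5). simpl in *.
  assert (W := w_pos (S n)). rewrite w_S in G2, G4, G5.
  assert (Hhw : 0 <= h * w (S n)) by (apply Rmult_le_pos; lra).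
  assert (Hkw : 0 <= k * w (S n)) by (apply Rmult_le_pos; lra).
  replace (h * (2 * w (S n))) with (2 * (h * w (S n))) in G2, G5 by ring.
  replace (k * (2 * w (S n))) with (2 * (k * w (S n))) in G4, G5 by ring.
  rewrite (flux_quarter p q x1 x2 y1 y2) in G5 by (auto; lra).
  set (hw := h * w (S n)) in *. set (kw := k * w (S n)) in *.
  set (f1 := flux p q a (a + hw) b (b + kw)) in *.
  set (f2 := flux p q (a + hw) (a + hw + hw) b (b + kw)) in *.
  set (f3 := flux p q a (a + hw) (b + kw) (b + kw + kw)) in *.
  set (f4 := flux p q (a + hw) (a + hw + hw) (b + kw) (b + kw + kw)) in *.
  assert (T : F * (2 * w (S n)) ^ 2 <= Rabs f1 + Rabs f2 + Rabs f3 + Rabs f4).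
  { eapply Rle_trans. exact G5.
    repeat (eapply Rle_trans; [apply Rabs_triang|]; apply Rplus_le_compat_r; try lra). }
  replace (F * (2 * w (S n)) ^ 2) with (4 * (F * w (S n) ^ 2)) in T by ring.
  assert (D : exists c', (c' = (a, b) \/ c' = (a + hw, b) \/ c' = (a, b + kw) \/
     c' = (a + hw, b + kw)) /\
     F * w (S n) ^ 2 <=
     Rabs (flux p q (fst c') (fst c' + hw) (snd c') (snd c' + kw))).
  (* Pigeonhole: one of the four quarters carries at least a quarter of the flux. *)
  { destruct (Rle_dec (F * w (S n) ^ 2) (Rabs f1)). exists (a, b); auto.
    destruct (Rle_dec (F * w (S n) ^ 2) (Rabs f2)). exists (a + hw, b); auto.
    destruct (Rle_dec (F * w (S n) ^ 2) (Rabs f3)). exists (a, b + kw); auto.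
    exists (a + hw, b + kw). split; [tauto|simpl; fold f4; lra]. }
  destruct D as (c' & D1 & D2). exists c'. unfold good, sub. rewrite (w_S n).
  fold hw kw.
  replace (h * (2 * w (S n))) with (2 * hw) by (unfold hw; ring).
  replace (k * (2 * w (S n))) with (2 * kw) by (unfold kw; ring).
  destruct D1 as [-> | [-> | [-> | ->]]]; simpl in *; repeat split; lra. }
(* Dependent choice: a corner is bundled with its proof of [good], so that the selection can be
   iterated. *)
set (next := fun n (c : {c | good n c}) =>
  let s := constructive_indefinite_description _ (step n (proj1_sig c) (proj2_sig c)) in
  exist (good (S n)) (proj1_sig s) (proj1 (proj2_sig s))).
assert (good0 : good 0%nat (x1, y1)).
{ unfold good, w; simpl. rewrite !Rmult_1_r.
  replace (x1 + h) with x2 by (unfold h; ring).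
  replace (y1 + k) with y2 by (unfold k; ring). fold F. repeat split; lra. }
set (cs := nat_rect (fun n => {c | good n c}) (exist _ _ good0) next).
assert (Hsub : forall n, sub n (proj1_sig (cs n)) (proj1_sig (cs (S n)))).
{ intros n. change (cs (S n)) with (next n (cs n)). unfold next. simpl.
  match goal with |- context [constructive_indefinite_description ?P ?e] =>
    destruct (constructive_indefinite_description P e) as [c' [Hc1 Hc2]] end.
  exact Hc2. }
destruct (nested_limit (fun n => fst (proj1_sig (cs n))) h Hh) as [x Hlx].
{ intros n. apply (Hsub n). }
destruct (nested_limit (fun n => snd (proj1_sig (cs n))) k Hk) as [y Hly].
{ intros n. apply (Hsub n). }
assert (Rx : x1 <= x <= x2).
{ destruct (proj2_sig (cs 0%nat)) as (G1 & G2 & _). specialize (Hlx 0%nat).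
  unfold w in G2. lra. }
assert (Ry : y1 <= y <= y2).
{ destruct (proj2_sig (cs 0%nat)) as (_ & _ & G1 & G2 & _). specialize (Hly 0%nat).
  unfold w in G2. lra. }
destruct (H x y Rx Ry) as (al & be & ga & Hp & Hq).
(* At a deep level [n] the retained flux [F * w n ^ 2] is at most [2 * eps * ((h + k) * w n) ^ 2],
   and [w n ^ 2] cancels. *)
assert (small : forall eps : posreal, F <= eps * (2 * (h + k) ^ 2)).
{ intros eps.
  destruct (flux_small p q x y al be ga eps x1 x2 y1 y2) as [d Hd]; auto.
  destruct (pow_half_lt (h + k) d) as [n Hn]; [lra|apply cond_pos|].
  fold (w n) in Hn. assert (W := w_pos n).
  destruct (proj2_sig (cs n)) as (G1 & G2 & G3 & G4 & G5).
  specialize (Hlx n). specialize (Hly n). simpl in Hlx, Hly.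
  fold (w n) in Hlx, Hly.
  assert (L := Hd _ _ (h * w n) (k * w n) G1 G2 G3 G4 Hlx Hly
    ltac:(nra) ltac:(nra)).
  apply Rmult_le_reg_r with (w n ^ 2). nra.
  eapply Rle_trans. exact G5. eapply Rle_trans. exact L.
  right. ring. }
assert (HF : 0 <= F) by apply Rabs_pos.
destruct (Rle_lt_or_eq_dec _ _ HF) as [P|E].
- exfalso. set (c := 2 * (h + k) ^ 2) in *.
  assert (0 <= c) by (unfold c; nra).
  (* With this [eps] the bound reads [F <= F * c / (c + 1)], impossible for [F > 0]. *)
  assert (Pe : 0 < F / (c + 1) ) by (apply Rdiv_lt_0_compat; lra).
  specialize (small (mkposreal _ Pe)). simpl in small.
  apply (Rmult_le_compat_r (c + 1)) in small; [|lra].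
  replace (F / (c + 1) * c * (c + 1)) with (F * c) in small by (field; lra). nra.
- destruct (Req_dec (flux p q x1 x2 y1 y2) 0) as [|N]; auto.
  apply Rabs_no_R0 in N. fold F in N. lra.
Qed.

(** * The maximum principle *)

(** Unpacks the filter definition of the derivative; the norms and balls involved convert to
    [Cmod]. *)
Lemma is_derive_C_eps (f : C -> C) (z d : C) (eps : posreal) :
  @is_derive C_AbsRing C_NormedModule f z d ->
  exists delta : posreal, forall w, Cmod (w - z)%C < delta ->
    Cmod (f w - f z - (w - z) * d)%C <= eps * Cmod (w - z)%C.
Proof.
intros [_ H].
destruct (H z (fun P HP => HP) eps) as [delta Hd].
exists delta. intros w Hw. exact (Hd w Hw).
Qed.

Lemma is_derive_C_intro (f : C -> C) (z d : C) :
  (forall eps : posreal, exists delta : posreal, forall w, Cmod (w - z)%C < delta ->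
    Cmod (f w - f z - (w - z) * d)%C <= eps * Cmod (w - z)%C) ->
  @is_derive C_AbsRing C_NormedModule f z d.
Proof.
intros H. split. apply (@is_linear_scal_l C_AbsRing C_NormedModule).
intros x Hx. apply (@is_filter_lim_locally_unique C_AbsRing (AbsRing_NormedModule C_AbsRing)) in Hx.
subst x. intros eps. destruct (H eps) as [delta Hd].
exists delta. intros w Hw. exact (Hd w Hw).
Qed.

(* Cauchy-Riemann: [(Re f, - Im f)] is divergence-free. *)
Lemma is_derive_C_differentiable (f : C -> C) (x y : R) (d : C) :
  @is_derive C_AbsRing C_NormedModule f (x, y) d ->
  differentiable_pt_lim (fun u v => Re (f (u, v))) x y (Re d) (- Im d) /\
  differentiable_pt_lim (fun u v => - Im (f (u, v))) x y (- Im d) (- Re d).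
Proof.
intros H.
assert (E : forall eps : posreal, exists delta : posreal, forall u v,
  Rabs (u - x) < delta -> Rabs (v - y) < delta ->
  Cmod (f (u, v) - f (x, y) - ((u, v) - (x, y)) * d)%C
     <= eps * Rmax (Rabs (u - x)) (Rabs (v - y))).
{ intros eps.
  assert (S2 : sqrt 2 <= 2).
  { rewrite <- (sqrt_Rsqr 2) at 2 by lra. apply sqrt_le_1_alt. unfold Rsqr. lra. }
  assert (P2 := Rlt_sqrt2_0).
  (* [Cmod] is at most [sqrt 2 <= 2] times the maximum norm; halving [eps] and [delta] absorbs this
     factor. *)
  destruct (is_derive_C_eps _ _ _ (pos_div_2 eps) H) as [delta Hd].
  exists (pos_div_2 delta). intros u v Hu Hv. simpl in Hu, Hv.
  assert (L := Cmod_2Rmax ((u, v) - (x, y))%C). simpl in L.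
  fold (u - x) (v - y) in L.
  set (m := Rmax (Rabs (u - x)) (Rabs (v - y))) in *.
  assert (m < delta / 2) by (unfold m; apply Rmax_lub_lt; assumption).
  assert (0 <= m) by (unfold m; eapply Rle_trans; [apply Rabs_pos | apply Rmax_l]).
  eapply Rle_trans. apply Hd. nra.
  simpl. assert (He := cond_pos eps).
  assert (Cmod ((u, v) - (x, y))%C <= 2 * m) by nra. nra. }
split; intros eps; destruct (E eps) as [delta Hd]; exists delta; intros u v Hu Hv;
  (eapply Rle_trans; [| apply (Hd u v Hu Hv)]);
  eapply Rle_trans; [| apply Rmax_Cmod | | apply Rmax_Cmod].
- eapply Rle_trans; [| apply Rmax_l]. right. f_equal.
  destruct d, (f (u, v)), (f (x, y)); simpl. ring.
- eapply Rle_trans; [| apply Rmax_r]. right. rewrite <- Rabs_Ropp. f_equal.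
  destruct d, (f (u, v)), (f (x, y)); simpl. ring.
Qed.

Lemma is_derive_C_cont (f : C -> C) (z : C) :
  @ex_derive C_AbsRing C_NormedModule f z ->
  forall eps : posreal, exists delta : posreal, forall w, Cmod (w - z)%C < delta ->
    Cmod (f w - f z)%C < eps.
Proof.
intros [d H] eps.
destruct (is_derive_C_eps _ _ _ (mkposreal 1 Rlt_0_1) H) as [delta Hd]. simpl in Hd.
assert (Hc := Cmod_ge_0 d). assert (He := cond_pos eps).
assert (P : 0 < Rmin delta (eps / (2 + Cmod d))).
{ apply Rmin_pos. apply cond_pos. apply Rdiv_lt_0_compat; lra. }
exists (mkposreal _ P). intros w Hw. simpl in Hw.
assert (W1 := Rlt_le_trans _ _ _ Hw (Rmin_l _ _)).
assert (W2 := Rlt_le_trans _ _ _ Hw (Rmin_r _ _)).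
specialize (Hd w W1).
replace (f w - f z)%C with ((f w - f z - (w - z) * d) + (w - z) * d)%C by ring.
eapply Rle_lt_trans. apply Cmod_triangle. rewrite Cmod_mult.
apply (Rmult_lt_compat_r (2 + Cmod d)) in W2; [|lra].
unfold Rdiv in W2. rewrite Rmult_assoc, Rinv_l, Rmult_1_r in W2 by lra.
assert (Hz := Cmod_ge_0 (w - z)%C). nra.
Qed.

(** * Logarithmic polar coordinates and the mean value property *)

Lemma differentiable_pt_lim_mul (x y : R) :
  differentiable_pt_lim (fun u v => u * v) x y y x.
Proof.
intros eps. exists eps. intros u v Hu Hv.
replace (u * v - x * y - (y * (u - x) + x * (v - y))) with ((u - x) * (v - y)) by ring.
rewrite Rabs_mult. apply Rmult_le_compat; try apply Rabs_pos. lra. apply Rmax_r.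
Qed.

Lemma differentiable_pt_lim_snd (f : R -> R) (x y l : R) :
  derivable_pt_lim f y l -> differentiable_pt_lim (fun _ v => f v) x y 0 l.
Proof.
intros H eps.
destruct (differentiable_pt_lim_proj1_0 f y x l H eps) as [d Hd].
exists d. intros u v Hu Hv. specialize (Hd v u Hv Hu).
rewrite Rmax_comm. rewrite Rplus_comm. exact Hd.
Qed.

Lemma differentiable_pt_lim_exp_mul (g : R -> R) (x y l : R) :
  derivable_pt_lim g y l ->
  differentiable_pt_lim (fun u v => exp u * g v) x y (exp x * g y) (exp x * l).
Proof.
intros H.
assert (D := differentiable_pt_lim_comp _ (fun u _ => exp u) (fun _ v => g v) x y
  _ _ _ _ _ _ (differentiable_pt_lim_mul (exp x) (g y))
  (differentiable_pt_lim_proj1_0 exp x y (exp x) (derivable_pt_lim_exp x))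
  (differentiable_pt_lim_snd g x y l H)).
replace (g y * exp x + exp x * 0) with (exp x * g y) in D by ring.
replace (g y * 0 + exp x * l) with (exp x * l) in D by ring.
exact D.
Qed.

(** The complex exponential of [rho + i th]: vertical segments of length [2 * PI] become circles
    about [0]. *)
Definition polar (rho th : R) : C := (exp rho * cos th, exp rho * sin th).

Lemma Cmod_polar rho th : Cmod (polar rho th) = exp rho.
Proof.
unfold Cmod, polar; simpl.
assert (E := sin2_cos2 th). unfold Rsqr in E.
replace (_ + _) with (exp rho * exp rho * (sin th * sin th + cos th * cos th)) by ring.
rewrite E, Rmult_1_r. apply sqrt_Rsqr. left. apply exp_pos.
Qed.

(** Since [polar] is holomorphic in [rho + i th], so is its composition with [h], and the
    Cauchy-Riemann equations persist in the new coordinates. *)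
Lemma polar_solenoidal (h : C -> C) (x1 x2 y1 y2 : R) :
  (forall x y, x1 <= x <= x2 -> @ex_derive C_AbsRing C_NormedModule h (polar x y)) ->
  solenoidal_on (fun x y => Re (h (polar x y))) (fun x y => - Im (h (polar x y)))
    x1 x2 y1 y2.
Proof.
intros H x y Hx _. destruct (H x y Hx) as [d Hd].
destruct (is_derive_C_differentiable _ _ _ _ Hd) as [D1 D2].
assert (Dc := differentiable_pt_lim_exp_mul cos x y _ (derivable_pt_lim_cos y)).
assert (Ds := differentiable_pt_lim_exp_mul sin x y _ (derivable_pt_lim_sin y)).
assert (P1 := differentiable_pt_lim_comp _ _ _ _ _ _ _ _ _ _ _ D1 Dc Ds).
assert (P2 := differentiable_pt_lim_comp _ _ _ _ _ _ _ _ _ _ _ D2 Dc Ds).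
do 3 eexists. split. exact P1.
match type of P2 with differentiable_pt_lim _ _ _ _ ?b =>
  match goal with |- differentiable_pt_lim _ _ _ _ ?c =>
    replace c with b by ring end end.
exact P2.
Qed.

(* Goursat on [[rho, 0] x [0, 2 PI]] in logarithmic polar coordinates: the two sides
   along which the angle is constant cancel by periodicity, so the mean of [Re h] over
   the circle of radius [exp rho] does not depend on [rho]. *)
Lemma mean_value_polar (h : C -> C) (rho : R) : rho <= 0 ->
  (forall z, Cmod z <= 1 -> @ex_derive C_AbsRing C_NormedModule h z) ->
  RInt (fun th => Re (h (polar rho th))) 0 (2 * PI) =
  RInt (fun th => Re (h (polar 0 th))) 0 (2 * PI) /\
  (forall x, rho <= x <= 0 -> ex_RInt (fun th => Re (h (polar x th))) 0 (2 * PI)).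
Proof.
intros Hr H. assert (HP := PI_RGT_0).
assert (S : solenoidal_on (fun x y => Re (h (polar x y)))
  (fun x y => - Im (h (polar x y))) rho 0 0 (2 * PI)).
{ apply polar_solenoidal. intros x y Hx. apply H. rewrite Cmod_polar.
  rewrite <- exp_0. destruct (proj2 Hx) as [L| ->]. left. apply exp_increasing, L. lra. }
split.
- assert (F := flux_zero _ _ rho 0 0 (2 * PI) Hr ltac:(lra) S). unfold flux in F; cbv beta in F.
  assert (P : forall x, polar x (2 * PI) = polar x 0).
  { intros x. unfold polar. rewrite cos_2PI, sin_2PI, cos_0, sin_0. reflexivity. }
  rewrite (RInt_ext (fun x => - Im (h (polar x (2 * PI))))
    (fun x => - Im (h (polar x 0)))) in F.
  lra. intros x _. rewrite P. reflexivity.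
- intros x Hx.
  apply (ex_RInt_slice_r _ _ _ _ _ _ _ x (proj1 (solenoidal_continuous _ _ _ _ _ _ S)));
  lra.
Qed.

(** The mean of [Re h] over a tiny circle is within [e] of the value at [0], and it equals the mean
    over the unit circle, which is at most [B]. *)
Lemma Re_max_at_center (h : C -> C) (B : R) :
  (forall z, Cmod z <= 1 -> @ex_derive C_AbsRing C_NormedModule h z) ->
  (forall z, Cmod z = 1 -> Re (h z) <= B) -> Re (h 0%C) <= B.
Proof.
intros H HB. apply le_epsilon. intros e He. assert (HP := PI_RGT_0).
destruct (is_derive_C_cont h 0%C (H 0%C ltac:(rewrite Cmod_0; lra)) (mkposreal e He))
  as [delta Hd]. simpl in Hd.
(* The circle of radius [exp rho] then lies in the unit disc and within [delta] of [0]. *)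
set (rho := Rmin 0 (ln delta - 1)).
assert (R1 : rho <= 0) by apply Rmin_l.
assert (R2 : exp rho < delta).
{ rewrite <- (exp_ln delta) by apply cond_pos. apply exp_increasing.
  assert (rho <= ln delta - 1) by apply Rmin_r. lra. }
destruct (mean_value_polar h rho R1 H) as [E I].
assert (U : RInt (fun th => Re (h (polar 0 th))) 0 (2 * PI) <= 2 * PI * B).
{ replace (2 * PI * B) with (RInt (fun _ => B) 0 (2 * PI))
    by (rewrite RInt_const; unfold scal; simpl; unfold mult; simpl; ring).
  apply RInt_le. lra. apply I; lra. apply (@ex_RInt_const R_NormedModule).
  intros th _. apply HB. rewrite Cmod_polar. apply exp_0. }
assert (L : 2 * PI * (Re (h 0%C) - e) <= RInt (fun th => Re (h (polar rho th))) 0 (2 * PI)).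
{ replace (2 * PI * (Re (h 0%C) - e)) with (RInt (fun _ => Re (h 0%C) - e) 0 (2 * PI))
    by (rewrite RInt_const; unfold scal; simpl; unfold mult; simpl; ring).
  apply RInt_le. lra. apply (@ex_RInt_const R_NormedModule). apply I; lra.
  intros th _.
  assert (D : Cmod (h (polar rho th) - h 0)%C < e).
  { apply Hd. replace (polar rho th - 0)%C with (polar rho th) by ring.
    rewrite Cmod_polar. exact R2. }
  assert (A := re_le_Cmod (h (polar rho th) - h 0)%C).
  assert (A' := Rabs_le_between (Re (h (polar rho th) - h 0)%C) e).
  destruct A' as [A' _]. specialize (A' ltac:(lra)).
  unfold Re in *. destruct (h (polar rho th)), (h 0%C). simpl in *. lra. }
rewrite E in L. assert (2 * PI * (Re (h 0%C) - e) <= 2 * PI * B) by lra.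
apply Rmult_le_reg_l in H0; lra.
Qed.

(** * Rules of complex differentiation and the Moebius maps of the disc *)

Lemma is_derive_Cinv (z : C) : z <> 0%C ->
  @is_derive C_AbsRing C_NormedModule Cinv z (- / (z * z))%C.
Proof.
intros Hz. apply is_derive_C_intro. intros eps.
set (m := Cmod z). assert (Hm : 0 < m) by (apply Cmod_gt_0, Hz).
assert (He := cond_pos eps).
(* The remainder is [(w - z)^2 / (z^2 w)]. The first bound keeps [Cmod w >= m / 2]; the second then
   makes [Cmod (w - z)] at most [eps * m^2 * Cmod w]. *)
assert (P : 0 < Rmin (m / 2) (eps * (m * m * m / 2))).
{ apply Rmin_pos. lra. repeat apply Rmult_lt_0_compat; lra. }
exists (mkposreal _ P). intros w Hw. simpl in Hw.
assert (W1 := Rlt_le_trans _ _ _ Hw (Rmin_l _ _)).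
assert (W2 := Rlt_le_trans _ _ _ Hw (Rmin_r _ _)).
assert (Hmw : m / 2 <= Cmod w).
{ assert (T := Cmod_triangle w (z - w)%C).
  replace (w + (z - w))%C with z in T by ring.
  rewrite <- (Cmod_opp (z - w)%C) in T.
  replace (- (z - w))%C with (w - z)%C in T by ring. fold m in T. lra. }
assert (Hw0 : w <> 0%C) by (apply Cmod_gt_0; lra).
replace (/ w - / z - (w - z) * - / (z * z))%C
  with ((w - z) * ((w - z) * / (z * z * w)))%C by (field; auto).
rewrite !Cmod_mult. rewrite (Rmult_comm eps).
apply Rmult_le_compat_l. apply Cmod_ge_0.
rewrite Cmod_inv by (repeat apply Cmult_neq_0; auto). rewrite !Cmod_mult. fold m.
apply Rmult_le_reg_r with (m * m * Cmod w). repeat apply Rmult_lt_0_compat; lra.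
rewrite Rmult_assoc, Rinv_l by (repeat apply Rmult_integral_contrapositive_currified; lra).
rewrite Rmult_1_r. left. eapply Rlt_le_trans. exact W2.
apply Rmult_le_compat_l. lra.
replace (m * m * m / 2) with (m * m * (m / 2)) by field.
apply Rmult_le_compat_l. nra. exact Hmw.
Qed.

(** [C] carries two normed module structures. The chain and product rules use the one coming from
    the ring; the estimates agree by conversion, and only linearity is proved anew. *)
Lemma is_derive_C_AbsRing (f : C -> C) (z d : C) :
  @is_derive C_AbsRing C_NormedModule f z d <->
  @is_derive C_AbsRing (AbsRing_NormedModule C_AbsRing) f z d.
Proof.
split; intros [_ H]; split; try exact H.
apply (@is_linear_scal_l C_AbsRing (AbsRing_NormedModule C_AbsRing)).
apply (@is_linear_scal_l C_AbsRing C_NormedModule).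
Qed.

Lemma is_derive_affine (a b z : C) :
  @is_derive C_AbsRing C_NormedModule (fun w => a * w + b)%C z a.
Proof.
apply is_derive_C_intro. intros eps. exists (mkposreal 1 Rlt_0_1). intros w _.
replace (a * w + b - (a * z + b) - (w - z) * a)%C with (RtoC 0) by ring.
rewrite Cmod_0. apply Rmult_le_pos. left. apply cond_pos. apply Cmod_ge_0.
Qed.

Lemma ex_derive_C_comp (f g : C -> C) (z : C) :
  @ex_derive C_AbsRing C_NormedModule f (g z) ->
  @ex_derive C_AbsRing C_NormedModule g z ->
  @ex_derive C_AbsRing C_NormedModule (fun w => f (g w)) z.
Proof.
intros [df Hf] [dg Hg]. apply is_derive_C_AbsRing in Hg.
eexists. exact (@is_derive_comp C_AbsRing C_NormedModule f g z df dg Hf Hg).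
Qed.

Lemma ex_derive_C_mult (f g : C -> C) (z : C) :
  @ex_derive C_AbsRing C_NormedModule f z ->
  @ex_derive C_AbsRing C_NormedModule g z ->
  @ex_derive C_AbsRing C_NormedModule (fun w => f w * g w)%C z.
Proof.
intros [df Hf] [dg Hg]. apply is_derive_C_AbsRing in Hf, Hg.
eexists. apply is_derive_C_AbsRing.
exact (@is_derive_mult C_AbsRing f g z df dg Hf Hg Cmult_comm).
Qed.

(** For [Cmod a < 1], the disc automorphism that sends [0] to [a]. *)
Definition moebius (a z : C) : C := ((z + a) * / (1 + Cconj a * z))%C.

Lemma moebius_denom_neq_0 (a z : C) :
  Cmod a < 1 -> Cmod z <= 1 -> (1 + Cconj a * z)%C <> 0%C.
Proof.
intros Ha Hz E.
assert (L : Cmod (Cconj a * z)%C < 1).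
{ rewrite Cmod_mult, Cmod_conj. assert (P := Cmod_ge_0 a). assert (Q := Cmod_ge_0 z). nra. }
replace (Cconj a * z)%C with (- (1))%C in L.
rewrite Cmod_m1 in L. lra.
replace (Cconj a * z)%C with (1 + Cconj a * z - 1)%C by ring. rewrite E. ring.
Qed.

Lemma ex_derive_moebius (a z : C) : Cmod a < 1 -> Cmod z <= 1 ->
  @ex_derive C_AbsRing C_NormedModule (moebius a) z.
Proof.
intros Ha Hz. assert (N := moebius_denom_neq_0 a z Ha Hz).
assert (D : forall b c w, @ex_derive C_AbsRing C_NormedModule (fun w => b * w + c)%C w)
  by (intros b c w; exists b; apply is_derive_affine).
apply (@ex_derive_ext C_AbsRing C_NormedModule
  (fun w => (1 * w + a) * / (Cconj a * w + 1))%C).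
{ intros w. unfold moebius. rewrite Cmult_1_l, (Cplus_comm _ 1). reflexivity. }
apply ex_derive_C_mult. apply D.
apply (ex_derive_C_comp Cinv (fun w => Cconj a * w + 1)%C).
eexists. apply is_derive_Cinv. rewrite Cplus_comm. exact N. apply D.
Qed.

(** For [Cmod z = 1], numerator and denominator both have squared modulus
    [1 + 2 Re (Cconj a * z) + Cmod a ^ 2]. *)
Lemma Cmod_moebius (a z : C) : Cmod a < 1 -> Cmod z = 1 -> Cmod (moebius a z) = 1.
Proof.
intros Ha Hz. assert (N := moebius_denom_neq_0 a z Ha ltac:(lra)).
unfold moebius. rewrite Cmod_mult, Cmod_inv by exact N.
replace (Cmod (z + a)%C) with (Cmod (1 + Cconj a * z)%C).
apply Rinv_r. apply Cmod_gt_0 in N. lra.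
assert (Hz2 : fst z ^ 2 + snd z ^ 2 = 1).
{ assert (E := Cmod2_alt z). rewrite Hz in E. unfold Re, Im in E. lra. }
unfold Cmod. f_equal. destruct a as [a1 a2], z as [z1 z2]. simpl in *.
transitivity (1 + 2 * (a1 * z1 + a2 * z2)
  + (a1 * a1 + a2 * a2) * (z1 * (z1 * 1) + z2 * (z2 * 1))). ring.
rewrite Hz2.
transitivity ((z1 * (z1 * 1) + z2 * (z2 * 1)) + 2 * (a1 * z1 + a2 * z2)
  + (a1 * a1 + a2 * a2)). rewrite Hz2. ring. ring.
Qed.

(** Precomposing with a scaled Moebius map moves [z] to the centre, and the factor [Cconj (f z)]
    makes the central value [Cmod (f z) ^ 2]. The bound on real parts gives
    [Cmod (f z) ^ 2 <= Cmod (f z) * B]. *)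
Lemma maximum_modulus (f : C -> C) (s B : R) (z : C) :
  entire f -> Cmod z < s -> (forall w, Cmod w = s -> Cmod (f w) <= B) ->
  Cmod (f z) <= B.
Proof.
intros Hf Hz HB. assert (Hs : 0 < s) by (assert (P := Cmod_ge_0 z); lra).
assert (Hsc : RtoC s <> 0%C) by (intros E; injection E; lra).
set (a := (z * / s)%C). set (c := Cconj (f z)).
assert (Cs : Cmod s = s) by (rewrite Cmod_R; apply Rabs_pos_eq; lra).
assert (Ha : Cmod a < 1).
{ unfold a. rewrite Cmod_mult, Cmod_inv, Cs by exact Hsc.
  apply Rmult_lt_reg_r with s. exact Hs. rewrite Rmult_assoc, Rinv_l by lra. lra. }
(* The summands [0] match the shape of [is_derive_affine]. *)
set (h := fun w => (c * f (s * moebius a w + 0) + 0)%C).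
assert (L : Re (h 0%C) <= Cmod c * B).
{ apply Re_max_at_center.
  - intros w Hw. unfold h.
    apply (ex_derive_C_comp (fun v => c * v + 0)%C (fun w => f (s * moebius a w + 0)%C)).
    eexists; apply is_derive_affine.
    apply (ex_derive_C_comp f (fun w => s * moebius a w + 0)%C). apply Hf.
    apply (ex_derive_C_comp (fun v => s * v + 0)%C (moebius a)).
    eexists; apply is_derive_affine. apply ex_derive_moebius; assumption.
  - intros w Hw. eapply Rle_trans. apply Rle_abs. eapply Rle_trans. apply re_le_Cmod.
    unfold h. rewrite !Cplus_0_r, Cmod_mult.
    apply Rmult_le_compat_l. apply Cmod_ge_0. apply HB.
    rewrite Cmod_mult, Cmod_moebius, Cs by assumption. ring. }
assert (E : h 0%C = RtoC (Cmod c ^ 2)).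
{ unfold h. replace (s * moebius a 0 + 0)%C with z.
  unfold c. rewrite Cmod_conj, Cmod2_conj. ring.
  unfold moebius, a. field. exact Hsc. }
rewrite E in L. unfold c in L. rewrite Cmod_conj in L. simpl in L.
assert (P := Cmod_ge_0 (f z)).
(* If [f z = 0] nothing can be divided out; [0 <= B] comes from the point [s] of the circle. *)
destruct P as [P|P]. nra. rewrite <- P.
eapply Rle_trans. apply (Cmod_ge_0 (f s)). apply HB, Cs.
Qed.

(** * The maximum modulus function *)

Lemma continuity_2d_Cmod_entire (f : C -> C) (x y : R) :
  entire f -> continuity_2d_pt (fun u v => Cmod (f (u, v))) x y.
Proof.
intros Hf. destruct (Hf (x, y)) as [d Hd].
destruct (is_derive_C_differentiable f x y d Hd) as [D1 D2].
assert (C1 : continuity_2d_pt (fun u v => Re (f (u, v))) x y)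
  by (apply differentiable_continuity_pt; do 2 eexists; exact D1).
assert (C2 : continuity_2d_pt (fun u v => - Im (f (u, v))) x y)
  by (apply differentiable_continuity_pt; do 2 eexists; exact D2).
apply (continuity_2d_pt_ext (fun u v => sqrt (Re (f (u, v)) * Re (f (u, v))
  + (- Im (f (u, v))) * (- Im (f (u, v)))))).
{ intros u v. unfold Cmod, Re, Im. f_equal. ring. }
apply (continuity_1d_2d_pt_comp sqrt).
- apply continuity_pt_filterlim. apply continuous_sqrt.
- apply continuity_2d_pt_plus; apply continuity_2d_pt_mult; assumption.
Qed.

(** Parametrising by the real part reduces compactness to the extreme value theorem on an interval;
    [sg] is meant to be [1] or [-1], for the upper or lower half. *)
Lemma bounded_on_semicircle (f : C -> C) (r sg : R) : entire f -> 0 <= r ->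
  exists B, forall x, - r <= x <= r -> Cmod (f (x, sg * sqrt (r * r - x * x))) <= B.
Proof.
intros Hf Hr.
destruct (continuity_ab_maj (fun x => Cmod (f (x, sg * sqrt (r * r - x * x)))) (- r) r)
  as [x0 [H _]].
- lra.
- intros x _. apply continuity_pt_filterlim.
  apply (continuous_comp_2 (fun x => x) (fun x => sg * sqrt (r * r - x * x))
    (fun u v => Cmod (f (u, v)))).
  + apply continuous_id.
  + apply (continuous_mult (fun _ => sg)). apply continuous_const.
    apply continuous_comp; [|apply continuous_sqrt].
    apply (@ex_derive_continuous R_AbsRing R_NormedModule (fun x => r * r - x * x)).
    auto_derive. exact I.
  + apply (proj1 (continuity_2d_pt_filterlim (fun u v => Cmod (f (u, v))) _ _)).
    apply continuity_2d_Cmod_entire, Hf.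
- eexists. exact H.
Qed.

Lemma bounded_on_circle (f : C -> C) (r : R) : entire f -> 0 <= r ->
  exists B, forall z, Cmod z = r -> Cmod (f z) <= B.
Proof.
intros Hf Hr.
destruct (bounded_on_semicircle f r 1 Hf Hr) as [B1 H1].
destruct (bounded_on_semicircle f r (-1) Hf Hr) as [B2 H2].
exists (Rmax B1 B2). intros [x y] Hz.
assert (E := Cmod2_alt (x, y)). rewrite Hz in E. simpl in E.
assert (Hx : - r <= x <= r) by nra.
assert (Ey : r * r - x * x = y * y) by lra.
specialize (H1 x Hx). specialize (H2 x Hx). rewrite Ey in H1, H2.
destruct (Rle_lt_dec 0 y) as [Hy|Hy].
- rewrite sqrt_square, Rmult_1_l in H1 by exact Hy.
  eapply Rle_trans. exact H1. apply Rmax_l.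
- replace (y * y) with ((- y) * (- y)) in H2 by ring.
  rewrite sqrt_square in H2 by lra. replace (-1 * - y) with y in H2 by ring.
  eapply Rle_trans. exact H2. apply Rmax_r.
Qed.

(** [real] discards infinite values: boundedness on the circle rules out plus infinity, the value at
    the point [r] minus infinity. *)
Lemma M_is_lub (f : C -> C) (r : R) : entire f -> 0 <= r ->
  is_lub_Rbar (fun y => exists z, Cmod z = r /\ y = Cmod (f z)) (M f r).
Proof.
intros Hf Hr. unfold M.
set (E := fun y => exists z, Cmod z = r /\ y = Cmod (f z)).
assert (L := Lub_Rbar_correct E). destruct L as [L1 L2].
destruct (bounded_on_circle f r Hf Hr) as [B HB].
assert (U : Rbar_le (Lub_Rbar E) B).
{ apply L2. intros y [z [Hz ->]]. apply HB, Hz. }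
assert (V : Rbar_le (Cmod (f r)) (Lub_Rbar E)).
{ apply L1. exists r. split; [|reflexivity]. rewrite Cmod_R. apply Rabs_pos_eq, Hr. }
destruct (Lub_Rbar E) as [l| |]; simpl in U, V; try contradiction.
split; assumption.
Qed.

Lemma Cmod_le_M (f : C -> C) (z : C) : entire f -> Cmod (f z) <= M f (Cmod z).
Proof.
intros Hf. apply (proj1 (M_is_lub f (Cmod z) Hf (Cmod_ge_0 z))). exists z. auto.
Qed.

Lemma M_le_bound (f : C -> C) (r B : R) : entire f -> 0 <= r ->
  (forall z, Cmod z = r -> Cmod (f z) <= B) -> M f r <= B.
Proof.
intros Hf Hr H. apply (proj2 (M_is_lub f r Hf Hr) B).
intros y [z [Hz ->]]. apply H, Hz.
Qed.

Lemma M_monotone (f : C -> C) (r s : R) : entire f -> 0 <= r <= s -> M f r <= M f s.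
Proof.
intros Hf [Hr [Hs| ->]]; [|lra].
apply M_le_bound; auto. intros z Hz.
apply (maximum_modulus f s). exact Hf. lra.
intros w <-. apply Cmod_le_M, Hf.
Qed.

(** A point of the circle of radius [L] is approached radially from inside, where [c] bounds [f]. *)
Lemma M_left_limit (f : C -> C) (a L c : R) : entire f -> a < L -> 0 < L ->
  (forall x, a <= x < L -> M f x <= c) -> M f L <= c.
Proof.
intros Hf Ha HL H. apply M_le_bound; [exact Hf|lra|]. intros z Hz.
apply le_epsilon. intros e He.
destruct (is_derive_C_cont f z (Hf z) (mkposreal e He)) as [delta Hd]. simpl in Hd.
assert (HD := cond_pos delta).
(* A nonnegative radius in [[a, L)] at distance less than [delta] from [L]. *)
set (x := Rmax a (Rmax 0 (L - delta / 2))).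
assert (X1 : a <= x) by apply Rmax_l.
assert (X2 : 0 <= x) by (eapply Rle_trans; [apply Rmax_l|apply Rmax_r]).
assert (X3 : L - delta / 2 <= x)
  by (eapply Rle_trans; [apply (Rmax_r 0)|apply Rmax_r]).
assert (X4 : x < L) by (repeat apply Rmax_lub_lt; lra).
assert (Q : Cmod (z * RtoC (x / L))%C = x).
{ rewrite Cmod_mult, Hz, Cmod_R, Rabs_pos_eq. field; lra.
  apply Rmult_le_pos. exact X2. left. apply Rinv_0_lt_compat, HL. }
assert (D : Cmod (z * RtoC (x / L) - z)%C < delta).
{ replace (z * RtoC (x / L) - z)%C with (z * RtoC (x / L - 1))%C.
  rewrite Cmod_mult, Hz, Cmod_R, Rabs_left1.
  replace (L * - (x / L - 1)) with (L - x) by (field; lra). lra.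
  apply Rmult_le_reg_r with L. exact HL. field_simplify; lra.
  rewrite RtoC_minus. ring. }
specialize (Hd _ D). rewrite <- Cmod_opp in Hd.
assert (T := Cmod_triangle (f (z * RtoC (x / L)))%C (- (f (z * RtoC (x / L)) - f z))%C).
replace (f (z * RtoC (x / L)) + - (f (z * RtoC (x / L)) - f z))%C with (f z) in T by ring.
assert (N := Cmod_le_M f (z * RtoC (x / L))%C Hf). rewrite Q in N.
specialize (H x (conj X1 X4)). lra.
Qed.

(** * Iteration *)

Lemma iter_ge (g : R -> R) (a x : R) (n : nat) :
  (forall r, a <= r -> r < g r) -> a <= x -> x <= Nat.iter n g x.
Proof.
intros Hg Hx. induction n as [|n IH]; simpl. lra.
assert (L := Hg (Nat.iter n g x)). lra.
Qed.

(** The second hypothesis combines domination with monotonicity; it applies along the orbit because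
    the [g]-iterates stay above [a]. *)
Lemma iter_le_iter (g h : R -> R) (a x y : R) (n : nat) :
  (forall r, a <= r -> r < g r) ->
  (forall r s, a <= r -> r <= s -> g r <= h s) ->
  a <= x -> x <= y -> Nat.iter n g x <= Nat.iter n h y.
Proof.
intros Hg Hgh Hx Hxy. induction n as [|n IH]; simpl. exact Hxy.
apply Hgh; auto. assert (L := iter_ge g a x n Hg Hx). lra.
Qed.

(* The hypothesis [Hl] is all that is used of left-continuity: it says that the
   supremum of a bounded orbit would satisfy [g L <= L]. *)
Lemma iter_unbounded (g : R -> R) (a B : R) :
  (forall r, a <= r -> r < g r) ->
  (forall r s, a <= r -> r <= s -> g r <= g s) ->
  (forall L, a < L -> (forall x, a <= x < L -> g x <= L) -> g L <= L) ->
  exists n, B <= Nat.iter n g a.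
Proof.
intros Hg Hm Hl. apply NNPP. intros N.
assert (U : forall n, Nat.iter n g a <= B).
{ intros n. apply Rnot_lt_le. intros H. apply N. exists n. lra. }
destruct (completeness (fun t => exists n, t = Nat.iter n g a)) as [L [L1 L2]].
- exists B. intros t [n ->]. apply U.
- exists a, 0%nat. reflexivity.
- assert (HL : a < L).
  { eapply Rlt_le_trans. apply (Hg a). lra. apply L1. exists 1%nat. reflexivity. }
  assert (HgL : g L <= L).
  (* If [g x > L] with [x < L], an iterate beyond [x] would be followed by one beyond [L]; so [x]
     would bound the orbit, against the choice of [L]. *)
  { apply Hl. exact HL. intros x [Hx1 Hx2].
    apply Rnot_lt_le. intros Hc.
    assert (L <= x); [|lra]. apply L2. intros t [n ->]. apply Rnot_lt_le. intros Hn.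
    assert (Nat.iter (S n) g a <= L) by (apply L1; exists (S n); reflexivity).
    simpl in H. assert (g x <= g (Nat.iter n g a)) by (apply Hm; lra). lra. }
  specialize (Hg L). lra.
Qed.

(** * Real powers and the functions [mu2] *)

Lemma exp_le_compat (x y : R) : x <= y -> exp x <= exp y.
Proof. intros [H| ->]; [left; apply exp_increasing, H|lra]. Qed.

Lemma rpow_pos_eq (x a : R) : 0 < x -> rpow x a = Rpower x a.
Proof. intros H. unfold rpow. destruct (Rlt_dec 0 x); tauto. Qed.

Lemma rpow_npos_eq (x a : R) : x <= 0 -> rpow x a = 0.
Proof. intros H. unfold rpow. destruct (Rlt_dec 0 x); lra. Qed.

Lemma rpow_ge_0 (x a : R) : 0 <= rpow x a.
Proof.
unfold rpow. destruct (Rlt_dec 0 x). left. apply exp_pos. lra.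
Qed.

Lemma rpow_le_compat (x y a : R) : 0 <= a -> x <= y -> rpow x a <= rpow y a.
Proof.
intros Ha Hxy. destruct (Rlt_le_dec 0 x) as [Hx|Hx].
- rewrite !rpow_pos_eq by lra. apply Rle_Rpower_l; lra.
- rewrite (rpow_npos_eq x) by lra. apply rpow_ge_0.
Qed.

Lemma rpow_rpow_cancel (x a b : R) : a * b = 1 -> 0 <= x -> rpow (rpow x a) b = x.
Proof.
intros Hab [Hx| <-].
- rewrite (rpow_pos_eq x) by exact Hx. rewrite rpow_pos_eq by apply exp_pos.
  rewrite Rpower_mult, Hab. apply Rpower_1, Hx.
- rewrite (rpow_npos_eq 0 a) by lra. apply rpow_npos_eq. lra.
Qed.

Lemma rpow_le_inv (x y a : R) : 0 < a -> rpow x a <= y -> x <= rpow y (1 / a).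
Proof.
intros Ha H. destruct (Rlt_le_dec 0 x) as [Hx|Hx].
- rewrite <- (rpow_rpow_cancel x a (1 / a)) by (try field; lra).
  apply rpow_le_compat. left. apply Rdiv_lt_0_compat; lra. exact H.
- eapply Rle_trans. exact Hx. apply rpow_ge_0.
Qed.

Lemma le_rpow (x a : R) : 1 <= x -> 1 <= a -> x <= rpow x a.
Proof.
intros Hx Ha. rewrite rpow_pos_eq by lra.
rewrite <- (Rpower_1 x) at 1 by lra. apply Rle_Rpower; assumption.
Qed.

Lemma mu2_monotone (f : C -> C) (eps r s : R) : entire f -> 0 < eps ->
  0 <= r <= s -> 1 <= M f r -> mu2 f eps r <= mu2 f eps s.
Proof.
intros Hf He Hr H1. assert (L := M_monotone f r s Hf Hr).
unfold mu2. apply exp_le_compat. apply rpow_le_compat. lra. apply ln_le; lra.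
Qed.

(** The bound [mu2 f eps x <= L] is solved for [M f x], passed to the limit by [M_left_limit], and
    converted back. *)
Lemma mu2_left_limit (f : C -> C) (eps a L : R) : entire f -> 0 < eps -> 0 < a -> a < L ->
  (forall r, a <= r -> 1 <= M f r) ->
  (forall x, a <= x < L -> mu2 f eps x <= L) -> mu2 f eps L <= L.
Proof.
intros Hf He Ha HL H1 H.
(* This makes [ln L] nonnegative, as cancelling the powers requires. *)
assert (L1 : 1 <= L).
{ eapply Rle_trans; [|apply (H a); lra]. unfold mu2. rewrite <- exp_0 at 1.
  apply exp_le_compat, rpow_ge_0. }
assert (lnL : 0 <= ln L) by (rewrite <- ln_1; apply ln_le; lra).
assert (B : M f L <= exp (rpow (ln L) (1 / eps))).
{ apply (M_left_limit f a); try lra. exact Hf. intros x Hx.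
  specialize (H1 x (proj1 Hx)). specialize (H x Hx). unfold mu2 in H.
  rewrite <- (exp_ln (M f x)) by lra. apply exp_le_compat, rpow_le_inv. exact He.
  apply ln_le in H; [|apply exp_pos]. rewrite ln_exp in H. exact H. }
specialize (H1 L ltac:(lra)). apply ln_le in B; [|lra]. rewrite ln_exp in B.
unfold mu2. rewrite <- (exp_ln L) at 2 by lra. apply exp_le_compat.
rewrite <- (rpow_rpow_cancel (ln L) (1 / eps) eps) by (try field; lra).
apply rpow_le_compat; lra.
Qed.

Lemma M_iter_unbounded (f : C -> C) (R0 B : R) : entire f -> exceeds_id_from (M f) R0 ->
  exists n, B <= Nat.iter n (M f) R0.
Proof.
intros Hf [HR H]. apply iter_unbounded. exact H.
- intros r s Hr Hs. apply M_monotone. exact Hf. lra.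
- intros L HL HM. apply (M_left_limit f R0); auto. lra.
Qed.

Lemma mu2_iter_unbounded (f : C -> C) (eps R0 B : R) : entire f -> 0 < eps ->
  (forall r, R0 <= r -> 1 <= M f r) -> exceeds_id_from (mu2 f eps) R0 ->
  exists n, B <= Nat.iter n (mu2 f eps) R0.
Proof.
intros Hf He H1 [HR H]. apply iter_unbounded. exact H.
- intros r s Hr Hs. apply mu2_monotone; auto. lra.
- intros L HL HM. apply (mu2_left_limit f eps R0); auto.
Qed.

(** * The two inclusions under strong log-regularity *)

Lemma ln_pos (x : R) : 1 < x -> 0 < ln x.
Proof. intros H. rewrite <- ln_1. apply ln_increasing; lra. Qed.

(* Strong log-regularity at [eps = 1/2], with [ln (M f s) > ln s], gives
   [ln (M f r) > (ln r) ^ 2] for [r = s ^ k]. *)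
Lemma mu2_half_between (f : C -> C) (R0 : R) :
  strongly_log_regular f -> exceeds_id_from (M f) R0 ->
  exists R1, 0 < R1 /\ forall r, R1 <= r ->
    1 <= M f r /\ r < mu2 f (1 / 2) r <= M f r.
Proof.
intros Hreg [HR0 HM].
destruct (Hreg (1 / 2)) as (R1 & k & HR1 & Hk & H). lra.
(* Beyond both thresholds and beyond [exp 1], so that [ln s >= 1] for [s >= s0]. *)
set (s0 := R0 + R1 + 3). exists (rpow s0 k).
assert (S0 : 3 <= s0) by (unfold s0; lra).
assert (S1 : s0 <= rpow s0 k) by (apply le_rpow; lra).
split. lra. intros r Hr.
set (s := rpow r (1 / k)).
assert (Es : rpow s k = r) by (apply rpow_rpow_cancel; [field|]; lra).
assert (Hs : s0 <= s).
{ rewrite <- (rpow_rpow_cancel s0 k (1 / k)) by (try field; lra).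
  apply rpow_le_compat; [|exact Hr]. left. apply Rdiv_lt_0_compat; lra. }
assert (Hsr : k * ln s = ln r).
{ rewrite <- Es, rpow_pos_eq by lra. unfold Rpower. rewrite ln_exp. reflexivity. }
assert (Hlnr : 1 < ln r).
{ assert (E3 := exp_le_3). rewrite <- (ln_exp 1).
  assert (exp 1 <= s) by lra.
  assert (ln (exp 1) <= ln s) by (apply ln_le; [apply exp_pos|assumption]).
  rewrite ln_exp in H1. rewrite ln_exp. nra. }
assert (Hlt : ln s < ln (M f s)) by (apply ln_increasing; [lra|apply HM; unfold s0 in *; lra]).
specialize (H s ltac:(unfold s0 in *; lra)). rewrite Es in H.
assert (Hy : k * ln (M f s) <= rpow (ln (M f r)) (1 / 2)).
{ rewrite <- (rpow_rpow_cancel (k * ln (M f s)) (1 / (1 / 2)) (1 / 2)) by (try field; nra).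
  apply rpow_le_compat. lra. exact H. }
assert (Hy' : ln r < rpow (ln (M f r)) (1 / 2)) by nra.
(* From here on the square root of [ln (M f r)] is at most [ln (M f r)], which gives [mu2 <= M]. *)
assert (Hln : 1 <= ln (M f r)).
{ apply Rnot_lt_le. intros Hc.
  assert (L : rpow (ln (M f r)) (1 / 2) <= rpow 1 (1 / 2)) by (apply rpow_le_compat; lra).
  rewrite (rpow_pos_eq 1) in L by lra. unfold Rpower in L.
  rewrite ln_1, Rmult_0_r, exp_0 in L. lra. }
assert (HMr : 1 < M f r).
{ destruct (Rle_lt_dec (M f r) 0) as [Hc|Hc].
  (* [ln] is [0] on nonpositive arguments, against [Hln]. *)
  - unfold ln in Hln. destruct (Rlt_dec 0 (M f r)); lra.
  - apply Rnot_le_lt. intros Hd. apply ln_le in Hd; [|exact Hc]. rewrite ln_1 in Hd. lra. }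
repeat split.
- lra.
- unfold mu2. rewrite <- (exp_ln r) at 1 by lra. apply exp_increasing, Hy'.
- unfold mu2. rewrite <- (exp_ln (M f r)) at 2 by lra. apply exp_le_compat.
  rewrite rpow_pos_eq by lra. rewrite <- (Rpower_1 (ln (M f r))) at 2 by lra.
  apply Rle_Rpower; lra.
Qed.

Lemma A_subset_Q2 (f : C -> C) (R0 : R) (z : C) :
  entire f -> strongly_log_regular f -> exceeds_id_from (M f) R0 ->
  A f R0 z -> Q2 f z.
Proof.
intros Hf Hreg HR [l Hl].
destruct (mu2_half_between f R0 Hreg HR) as (R1 & HR1 & H).
destruct (M_iter_unbounded f R0 R1 Hf HR) as [m Hm].
(* The delay [m] brings the [M]-orbit of [R0] above [R1], the start of the [mu2]-orbit. *)
exists (1 / 2), (m + l)%nat, R1. repeat split; try lra.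
- intros r Hr. apply H, Hr.
- intros r Hr. apply H, Hr.
- intros n. rewrite Nat.add_assoc. eapply Rle_trans; [|apply Hl].
  rewrite Nat.iter_add. apply (iter_le_iter _ _ R1); try lra.
  + intros r Hr. apply H, Hr.
  + intros r s Hr Hs. eapply Rle_trans. apply H, Hr. apply M_monotone; auto. lra.
Qed.

Lemma Q2_subset_A (f : C -> C) (R0 : R) (z : C) :
  entire f -> strongly_log_regular f -> exceeds_id_from (M f) R0 ->
  Q2 f z -> A f R0 z.
Proof.
intros Hf Hreg [HR0 HM] (eps & l & Rq & He & H1 & [HRq Hmu] & Hl).
destruct (Hreg eps He) as (R1 & k & HR1 & Hk & H).
(* Beyond all three thresholds and above [1], so that [s <= s^k] for [s >= r]. *)
set (r := R0 + R1 + Rq + 1).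
destruct (mu2_iter_unbounded f eps Rq (rpow r k) Hf (proj1 He) H1 (conj HRq Hmu))
  as [m Hm].
exists (m + l)%nat. intros n. rewrite Nat.add_assoc.
eapply Rle_trans; [|apply Hl]. rewrite Nat.iter_add.
assert (Hr : forall j, r <= Nat.iter j (M f) r)
  by (intros j; apply (iter_ge _ R0); [exact HM|unfold r; lra]).
assert (P : forall j, rpow (Nat.iter j (M f) r) k <=
  Nat.iter j (mu2 f eps) (Nat.iter m (mu2 f eps) Rq)).
{ induction j as [|j IH]. exact Hm. simpl.
  specialize (Hr j). set (s := Nat.iter j (M f) r) in *.
  assert (Hs : R0 + R1 + Rq + 1 <= s) by (unfold r in Hr; lra).
  assert (Hsk : s <= rpow s k) by (apply le_rpow; lra).
  assert (HMs : s < M f s) by (apply HM; lra).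
  assert (Hln := ln_pos (M f s) ltac:(lra)).
  (* By the induction hypothesis and monotonicity it suffices that [(M f s)^k <= mu2 f eps (s^k)],
     which is regularity at [s] raised to the power [eps]. *)
  eapply Rle_trans; [|apply mu2_monotone; [exact Hf|lra|split; [|exact IH]; lra|apply H1; lra]].
  unfold mu2. rewrite rpow_pos_eq by lra. unfold Rpower. apply exp_le_compat.
  rewrite <- (rpow_rpow_cancel (k * ln (M f s)) (1 / eps) eps) by (try field; nra).
  apply rpow_le_compat. lra. apply H. lra. }
eapply Rle_trans; [|apply P].
(* The power [k] is dropped, and then the [M]-orbits of [R0] and [r] are compared. *)
eapply Rle_trans; [|apply le_rpow; [specialize (Hr n); unfold r in *; lra|lra]].
apply (iter_le_iter _ _ R0); try (unfold r; lra). exact HM.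
intros u v Hu Hv. apply M_monotone; auto. lra.
Qed.

Theorem theorem2p1 (f : C -> C) (hf : transcendental_entire f)
    (hreg : strongly_log_regular f)
    (R0 : R) (hR0 : exceeds_id_from (M f) R0) :
  forall z : C, Q2 f z <-> A f R0 z.
Proof.
destruct hf as [Hf _]. intros z. split.
- apply Q2_subset_A; assumption.
- apply A_subset_Q2; assumption.
Qed.
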